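(* The inclusion $cs^{\lambda}\subset cs$ holds if and only if $S(x)\in cs$ for every sequence $x\in cs^{\lambda}$.
   Context: $\mathbb{N}=\{0,1,2,\dots\}$ and $w=\mathbb{C}^{\mathbb{N}}$ is the space of all complex sequences. $\lambda=(\lambda_k)_{k\in\mathbb{N}}$ is a fixed strictly increasing sequence of positive reals tending to infinity, with the convention $\lambda_{-1}=0$. For $x=(x_k)\in w$ put $\Lambda(x)=(\Lambda_n(x))_{n\in\mathbb{N}}$, $\Lambda_n(x)=\frac{1}{\lambda_n}\sum_{k=0}^{n}(\lambda_k-\lambda_{k-1})x_k$, and $S(x)=(S_n(x))_{n\in\mathbb{N}}$, where $S_0(x)=0$ and $S_n(x)=\frac{1}{\lambda_n}\sum_{k=1}^{n}\lambda_{k-1}(x_k-x_{k-1})$ for $n\geq 1$. $cs$ is the space of sequences $x\in w$ such that $\sum_n x_n$ converges, and $cs^{\lambda}=\{x\in w:\Lambda(x)\in cs\}$. *)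

(* Defs.v *)
From Stdlib Require Import Reals.
From Coquelicot Require Import Coquelicot.

Local Open Scope C_scope.

(* [lam_pred lam k] is lambda_{k-1}, with lambda_{-1} = 0. *)
Definition lam_pred (lam : nat -> R) (k : nat) : R :=
  match k with
  | O => 0%R
  | S j => lam j
  end.

Definition Lambda_op (lam : nat -> R) (x : nat -> C) (n : nat) : C :=
  / RtoC (lam n)
  * sum_n_m (fun k : nat => RtoC (lam k - lam_pred lam k) * x k) 0 n.

(* [x (pred k)] is x_{k-1}, used only for k >= 1. *)
Definition S_op (lam : nat -> R) (x : nat -> C) (n : nat) : C :=
  match n with
  | O => RtoC 0
  | S _ =>
      / RtoC (lam n)
      * sum_n_m (fun k : nat => RtoC (lam_pred lam k) * (x k - x (pred k))) 1 n
  end.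

Definition cs (x : nat -> C) : Prop := ex_series x.

Definition cs_lambda (lam : nat -> R) (x : nat -> C) : Prop :=
  cs (Lambda_op lam x).

(* Main.v *)
(** Summation by parts gives [x n = Lambda_n x + S_n x]; as [Lambda x] lies in [cs] for [x] in
    [cs_lambda], the series of [x] and of [S x] converge together. *)

Require Import Defs.
From Stdlib Require Import Reals Lia.
From Coquelicot Require Import Coquelicot.

Local Open Scope C_scope.

(** Dividing the Abel summation identity [sum_by_parts] by [lam n] splits every sequence termwise as
    its [Lambda_op] part plus its [S_op] part ([Lambda_plus_S]). Convergent series are closed under
    sums and differences, so once the [Lambda_op] part is summable, [x] and [S_op lam x] are
    summable together. The equivalence thus holds for each [x] separately. *)

(** For k >= 1 the two k-th terms add up to lambda_k x_k - lambda_{k-1} x_{k-1}, which telescopes;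
    the k = 0 term is lambda_0 x_0 because lambda_{-1} = 0. *)
Lemma sum_by_parts (lam : nat -> R) (x : nat -> C) (n : nat) :
  sum_n_m (fun k : nat => RtoC (lam k - lam_pred lam k) * x k) 0 n
  + sum_n_m (fun k : nat => RtoC (lam_pred lam k) * (x k - x (pred k))) 1 n
  = RtoC (lam n) * x n.
Proof.
  induction n as [|n IH].
  - rewrite sum_n_n, sum_n_m_zero by lia.
    change (@zero C_AbelianMonoid) with (RtoC 0).
    rewrite RtoC_minus. simpl. ring.
  - rewrite !sum_n_Sm by lia.
    change (@plus C_AbelianMonoid) with Cplus.
    simpl lam_pred. simpl pred. rewrite RtoC_minus.
    match goal with |- ?a + ?b + (?c + ?d) = _ =>
      replace (a + b + (c + d)) with (a + c + (b + d)) by ring end.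
    rewrite IH. ring.
Qed.

Lemma Lambda_plus_S (lam : nat -> R) (x : nat -> C) (n : nat) :
  lam n <> 0%R -> Lambda_op lam x n + S_op lam x n = x n.
Proof.
  intros Hn.
  assert (Hn' : RtoC (lam n) <> 0) by (intros H; apply Hn, RtoC_inj, H).
  pose proof (sum_by_parts lam x n) as H.
  assert (E : x n = / RtoC (lam n) * (RtoC (lam n) * x n)) by (field; exact Hn').
  rewrite E, <- H, Cmult_plus_distr_l.
  (* At index 0 [S_op] is a literal 0 rather than a scaled sum, so it has to be matched with the
     empty sum from 1 to 0. *)
  destruct n as [|n]; [|reflexivity].
  unfold Lambda_op, S_op.
  rewrite (sum_n_m_zero _ 1 0) by lia.
  change (@zero C_AbelianMonoid) with (RtoC 0). ring.
Qed.

Theorem theorem3p5 :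
  forall (lam : nat -> R)
    (lam_pos : forall k : nat, (0 < lam k)%R)
    (lam_incr : forall m n : nat, (m < n)%nat -> (lam m < lam n)%R)
    (lam_infty : is_lim_seq lam p_infty),
    (forall x : nat -> C, cs_lambda lam x -> cs x) <->
    (forall x : nat -> C, cs_lambda lam x -> cs (S_op lam x)).
Proof.
  intros lam lam_pos _ _.
  assert (D : forall x n, Lambda_op lam x n + S_op lam x n = x n)
    by (intros x n; apply Lambda_plus_S, Rgt_not_eq, lam_pos).
  split; intros H x Hx; specialize (H x Hx); unfold cs_lambda, cs in *.
  - eapply ex_series_ext; [|exact (ex_series_minus _ _ H Hx)].
    intros n. change (x n - Lambda_op lam x n = S_op lam x n).
    rewrite <- (D x n) at 1. ring.
  - eapply ex_series_ext; [|exact (ex_series_plus _ _ Hx H)].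
    exact (D x).
Qed.
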